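(* Under Assumptions 1-MP, 2-MP (a),(b),(c) and 3-MP of the multi-period setup below, for all $g,k\in\mathcal{G}\setminus\{\mathcal{T}+1\}$ with $k>g$: $$\delta^{WITHIN}(g)=\int_{\mathcal{D}_+}w_1^{within}(g,l)\,\frac{\partial\pi_D^{POST(g),PRE(g)}(g,l)}{\partial l}\,dl,$$ $$\delta^{MID,PRE}(g,k)=\int_{\mathcal{D}_+}w_1(g,l)\frac{\partial\pi_D^{MID(g,k),PRE(g)}(g,l)}{\partial l}dl+w_0(g)\frac{\pi_D^{MID(g,k),PRE(g)}(g,d_L)}{d_L}-w_0(g)\frac{\pi^{MID(g,k),PRE(g)}(k)}{d_L},$$ $$\delta^{POST,MID}(g,k)=\int_{\mathcal{D}_+}w_1(k,l)\frac{\partial\pi_D^{POST(k),MID(g,k)}(k,l)}{\partial l}dl+w_0(k)\frac{\pi_D^{POST(k),MID(g,k)}(k,d_L)}{d_L}-w_0(k)\frac{\pi^{POST(k),PRE(g)}(g)-\pi^{MID(g,k),PRE(g)}(g)}{d_L},$$ and, when $\mathbb{E}[D\mid G=g]\neq\mathbb{E}[D\mid G=k]$, $$\delta^{POST,PRE}(g,k)=\int_{\mathcal{D}_+}w_1^{across}(g,k,l)\frac{\partial\pi_D^{POST(k),PRE(g)}(g,l)}{\partial l}dl-\Big\{\int_{\mathcal{D}_+}\tilde w_1^{across}(g,k,l)\Big(\frac{\partial\pi_D^{POST(k),PRE(g)}(k,l)}{\partial l}-\frac{\partial\pi_D^{POST(k),PRE(g)}(g,l)}{\partial l}\Big)dl+\tilde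 w_0^{across}(g,k)\frac{\pi_D^{POST(k),PRE(g)}(k,d_L)-\pi_D^{POST(k),PRE(g)}(g,d_L)}{d_L}\Big\}.$$ Moreover $w_1^{within}(g,l)\ge0$, $w_1(g,l)\ge0$, $w_0(g)\ge0$, $\int_{\mathcal{D}_+}w_1^{within}(g,l)dl=1$, $\int_{\mathcal{D}_+}w_1(g,l)dl+w_0(g)=1$, and $\int_{\mathcal{D}_+}w_1^{across}(g,k,l)dl=1$.
   Context: Multi-period setup. Periods $t=1,\dots,\mathcal{T}$. Each unit has a timing group $G\in\mathcal{G}\subseteq\{2,\dots,\mathcal{T}+1\}$ ($G=\mathcal{T}+1$ means never treated) and a dose $D\ge0$, with $D=0$ exactly for never-treated units and $D\in\mathcal{D}_+$ for units with $G\le\mathcal{T}$. Potential outcomes $Y_t(g,d)$; $Y_t(0):=Y_t(\mathcal{T}+1,0)$. $W_t:=D\mathbf{1}\{t\ge G\}$. Observed $Y_t=Y_t(0)\mathbf{1}\{t<G\}+Y_t(G,D)\mathbf{1}\{t\ge G\}$; finite second moments. 1-MP: $\{Y_{i1},\dots,Y_{i\mathcal{T}},D_i,G_i\}$ i.i.d. 2-MP: (a) support of $D$ is $\{0\}\cup\mathcal{D}_+$, $\mathbb{P}(D=0)>0$, every $d\in\mathcal{D}_+$ is in the support of $D\mid G=g$ for $g\le\mathcal{T}$; (b) $\mathcal{D}_+=[d_L,d_U]$, $0<d_L<d_U<\infty$; (c) $d\mapsto\mathbb{E}[\Delta Y_t\mid G=g,D=d]$ is continuously differentiable on $\mathcal{D}_+$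 for $g\le\mathcal{T}$, $t=2,\dots,\mathcal{T}$. 3-MP: (a) $Y_t(g,d)=Y_t(0)$ for $t<g$; (b) $W_1=0$ and $W_{t-1}=d\Rightarrow W_t=d$. Notation: $\bar Y^{(t_1,t_2)}:=\frac1{t_2-t_1+1}\sum_{t=t_1}^{t_2}Y_t$; for $g<k$: $PRE(g)=(1,g-1)$, $MID(g,k)=(g,k-1)$, $POST(k)=(k,\mathcal{T})$, and $\bar Y^{A}$ denotes the average over window $A$. For windows $A,B$: $\pi_D^{A,B}(g,d):=\mathbb{E}[\bar Y^A-\bar Y^B\mid G=g,D=d]-\mathbb{E}[\bar Y^A-\bar Y^B\mid D=0]$ and $\pi^{A,B}(g):=\mathbb{E}[\bar Y^A-\bar Y^B\mid G=g]-\mathbb{E}[\bar Y^A-\bar Y^B\mid D=0]$. Comparisons: $\delta^{WITHIN}(g):=\mathrm{cov}(\bar Y^{POST(g)}-\bar Y^{PRE(g)},D\mid G=g)/\mathrm{var}(D\mid G=g)$; $\delta^{MID,PRE}(g,k):=(\mathbb{E}[\bar Y^{MID(g,k)}-\bar Y^{PRE(g)}\mid G=g]-\mathbb{E}[\bar Y^{MID(g,k)}-\bar Y^{PRE(g)}\mid G=k])/\mathbb{E}[D\mid G=g]$; $\delta^{POST,MID}(g,k):=(\mathbb{E}[\bar Y^{POST(k)}-\bar Y^{MID(g,k)}\mid G=k]-\mathbb{E}[\bar Y^{POST(k)}-\bar Y^{MID(g,k)}\mid G=g])/\mathbb{E}[D\mid G=k]$; $\delta^{POST,PRE}(g,k):=(\mathbb{E}[\bar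 Y^{POST(k)}-\bar Y^{PRE(g)}\mid G=g]-\mathbb{E}[\bar Y^{POST(k)}-\bar Y^{PRE(g)}\mid G=k])/(\mathbb{E}[D\mid G=g]-\mathbb{E}[D\mid G=k])$. Weights: $w_1^{within}(g,l):=\frac{(\mathbb{E}[D\mid G=g,D\ge l]-\mathbb{E}[D\mid G=g])\mathbb{P}(D\ge l\mid G=g)}{\mathrm{var}(D\mid G=g)}$; $w_1(g,l):=\frac{\mathbb{P}(D\ge l\mid G=g)}{\mathbb{E}[D\mid G=g]}$; $w_0(g):=\frac{d_L}{\mathbb{E}[D\mid G=g]}$; $w_1^{across}(g,k,l):=\frac{\mathbb{P}(D\ge l\mid G=g)-\mathbb{P}(D\ge l\mid G=k)}{\mathbb{E}[D\mid G=g]-\mathbb{E}[D\mid G=k]}$; $\tilde w_1^{across}(g,k,l):=\frac{\mathbb{P}(D\ge l\mid G=k)}{\mathbb{E}[D\mid G=g]-\mathbb{E}[D\mid G=k]}$; $\tilde w_0^{across}(g,k):=\frac{d_L}{\mathbb{E}[D\mid G=g]-\mathbb{E}[D\mid G=k]}$. *)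

(* Defs.v *)
From HB Require Import structures.
From mathcomp Require Import all_boot all_order all_algebra.
From mathcomp Require Import all_classical all_reals all_analysis.
Set Implicit Arguments. Unset Strict Implicit. Unset Printing Implicit Defensive.
Import Order.TTheory GRing.Theory Num.Theory.
Import numFieldNormedType.Exports.
Local Open Scope classical_set_scope.
Local Open Scope ring_scope.

Section Defs.
Context {disp : measure_display} {Omega : measurableType disp} {R : realType}.
Variable P : probability Omega R.

Definition Ex (X : Omega -> R) : R := fine (\int[P]_w (X w)%:E).
Definition Pr (A : set Omega) : R := fine (P A).

Definition CE (X : Omega -> R) (A : set Omega) : R :=
  Ex (fun w => X w * \1_A w) / Pr A.

Definition condPr (B A : set Omega) : R := Pr (B `&` A) / Pr A.

Definition ccov (X Y : Omega -> R) (A : set Omega) : R :=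
  CE (fun w => (X w - CE X A) * (Y w - CE Y A)) A.
Definition cvar (X : Omega -> R) (A : set Omega) : R := ccov X X A.

Definition in_support (X : Omega -> R) (x : R) : Prop :=
  forall e : R, 0 < e -> (0 < P [set w | (`|X w - x| < e)%R])%E.

(** [m] is a version of the regression function d |-> E[X | G = g, D = d]. *)
Definition reg_fun (G : Omega -> nat) (D : Omega -> R) (g : nat)
    (X : Omega -> R) (m : R -> R) : Prop :=
  measurable_fun setT m /\
  P.-integrable setT (fun w => (m (D w) * \1_[set w | G w = g] w)%:E) /\
  forall B : set R, measurable B ->
    Ex (fun w => X w * \1_([set w | G w = g] `&` D @^-1` B) w) =
    Ex (fun w => m (D w) * \1_([set w | G w = g] `&` D @^-1` B) w).

End Defs.

Definition evG {Omega : Type} (G : Omega -> nat) (g : nat) : set Omega :=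
  [set w | G w = g].
Definition evD0 {Omega : Type} {R : realType} (D : Omega -> R) : set Omega :=
  [set w | D w = 0].
Definition evDge {Omega : Type} {R : realType} (D : Omega -> R) (l : R) : set Omega :=
  [set w | l <= D w].

Definition Ybar {Omega : Type} {R : realType} (Y : nat -> Omega -> R)
    (A : nat * nat) : Omega -> R :=
  fun w => (\sum_(A.1 <= t < A.2.+1) Y t w) / (A.2.+1 - A.1)%:R.

Definition PRE (g : nat) : nat * nat := (1%N, g.-1).
Definition MID (g k : nat) : nat * nat := (g, k.-1).
Definition POST (TT k : nat) : nat * nat := (k, TT).

Definition Wdiff {Omega : Type} {R : realType} (Y : nat -> Omega -> R)
    (A B : nat * nat) : Omega -> R :=
  fun w => Ybar Y A w - Ybar Y B w.

(** Observed outcome Y_t = Y_t(0) 1{t<G} + Y_t(G,D) 1{t>=G},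
    with Y_t(0) := Y_t(TT+1, 0). *)
Definition Yobs {Omega : Type} {R : realType} (TT : nat)
    (Ypo : nat -> nat -> R -> Omega -> R) (G : Omega -> nat) (D : Omega -> R)
    (t : nat) : Omega -> R :=
  fun w => if (t < G w)%N then Ypo t TT.+1 0 w else Ypo t (G w) (D w) w.

Definition Wtr {Omega : Type} {R : realType} (G : Omega -> nat) (D : Omega -> R)
    (t : nat) : Omega -> R :=
  fun w => if (G w <= t)%N then D w else 0.

Definition C1_on {R : realType} (a b : R) (f : R -> R) : Prop :=
  {within `[a, b], continuous f} /\
  (forall x, a < x < b -> derivable f x 1) /\
  exists f' : R -> R, {within `[a, b], continuous f'} /\
    (forall x, a < x < b -> derive1 f x = f' x).

Section Estimands.
Context {disp : measure_display} {Omega : measurableType disp} {R : realType}.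
Variable P : probability Omega R.
Variables (Y : nat -> Omega -> R) (G : Omega -> nat) (D : Omega -> R).

(** pi_D^{A,B}(g,d), where m is the regression d |-> E[Ybar^A-Ybar^B | G=g, D=d]. *)
Definition piD (A B : nat * nat) (m : R -> R) (d : R) : R :=
  m d - CE P (Wdiff Y A B) (evD0 D).
Definition piG (A B : nat * nat) (g : nat) : R :=
  CE P (Wdiff Y A B) (evG G g) - CE P (Wdiff Y A B) (evD0 D).

Definition deltaWithin (TT g : nat) : R :=
  ccov P (Wdiff Y (POST TT g) (PRE g)) D (evG G g) / cvar P D (evG G g).
Definition deltaMidPre (g k : nat) : R :=
  (CE P (Wdiff Y (MID g k) (PRE g)) (evG G g)
   - CE P (Wdiff Y (MID g k) (PRE g)) (evG G k)) / CE P D (evG G g).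
Definition deltaPostMid (TT g k : nat) : R :=
  (CE P (Wdiff Y (POST TT k) (MID g k)) (evG G k)
   - CE P (Wdiff Y (POST TT k) (MID g k)) (evG G g)) / CE P D (evG G k).
Definition deltaPostPre (TT g k : nat) : R :=
  (CE P (Wdiff Y (POST TT k) (PRE g)) (evG G g)
   - CE P (Wdiff Y (POST TT k) (PRE g)) (evG G k))
  / (CE P D (evG G g) - CE P D (evG G k)).

Definition w1within (g : nat) (l : R) : R :=
  (CE P D (evG G g `&` evDge D l) - CE P D (evG G g))
  * condPr P (evDge D l) (evG G g) / cvar P D (evG G g).
Definition w1 (g : nat) (l : R) : R :=
  condPr P (evDge D l) (evG G g) / CE P D (evG G g).
Definition w0 (dL : R) (g : nat) : R := dL / CE P D (evG G g).
Definition w1across (g k : nat) (l : R) : R :=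
  (condPr P (evDge D l) (evG G g) - condPr P (evDge D l) (evG G k))
  / (CE P D (evG G g) - CE P D (evG G k)).
Definition tw1across (g k : nat) (l : R) : R :=
  condPr P (evDge D l) (evG G k) / (CE P D (evG G g) - CE P D (evG G k)).
Definition tw0across (dL : R) (g k : nat) : R :=
  dL / (CE P D (evG G g) - CE P D (evG G k)).
End Estimands.

(* Main.v *)
Require Import Defs.
From HB Require Import structures.
From mathcomp Require Import all_boot all_order all_algebra.
From mathcomp Require Import all_classical all_reals all_analysis.
From mathcomp Require Import measurable_realfun.
From mathcomp Require Import ring lra.
Import Order.TTheory GRing.Theory Num.Theory.
Import numFieldNormedType.Exports.
Local Open Scope classical_set_scope.
Local Open Scope ring_scope.

(** Layer cake: on the event [G = g] one has, for [f] of class C1 on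
    [[dL, dU]], [f D - f dL = \int_dL^dU 1{l <= D} f' l dl].  Multiplying by an
    integrable [Z] supported on that event and exchanging the integrals (Fubini)
    gives [\int E[Z 1{l <= D}] f' l dl = E[Z (f D - f dL)]].
    The choice [Z = 1{G = g}] yields the weights [w1], and [Z = (D - E[D | G = g])
    1{G = g}] the weights [w1within]; [f] is the regression function, or the
    identity for the total mass of the weights.  The covariance
    involves [E[X D 1{G = g}]], where [X] may be replaced by its regression on
    [D]: apply the layer cake to [f = id], once with [Z = X 1{G = g}] and once with
    [Z = m(D) 1{G = g}], whose tail expectations agree. *)

(** * Fubini's theorem on the product of the dose axis and the sample space *)

Section LayerCake.
Context {disp : measure_display} {Omega : measurableType disp} {R : realType}.
Variable P : probability Omega R.
Local Notation mu := (@lebesgue_measure R).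
Implicit Types (Z D : Omega -> R) (g : R -> R).

(** Both sides are iterated integrals of [Z w * 1{l <= D w} * g l]. Product integrability comes from
    the bound [|Z w| * |g l|], whose double integral factors. *)
Lemma layer_cake Z D g :
  P.-integrable setT (EFin \o Z) -> measurable_fun setT D ->
  mu.-integrable setT (EFin \o g) ->
  mu.-integrable setT
    (fun l => (Ex P (fun w => Z w * \1_(evDge D l) w) * g l)%:E) /\
  (\int[mu]_l (Ex P (fun w => Z w * \1_(evDge D l) w) * g l)%:E =
   (Ex P (fun w => (Z w * Rintegral mu [set l | l <= D w] g)%R))%:E)%E.
Proof.
move=> iZ mD ig.
pose S : set (R * Omega) := [set lw | lw.1 <= D lw.2].
have mS : measurable S.
  rewrite -[S]setTI; apply: measurable_fun_le => //.
  exact: measurableT_comp mD measurable_snd.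
have mZ : measurable_fun setT Z.
  by apply/measurable_EFinP; exact: measurable_int iZ.
have mg : measurable_fun setT g.
  by apply/measurable_EFinP; exact: measurable_int ig.
pose F (lw : R * Omega) : \bar R := (Z lw.2 * (\1_S lw * g lw.1))%:E.
have mF : measurable_fun setT F.
  apply/measurable_EFinP; apply: measurable_funM.
    exact: measurableT_comp mZ measurable_snd.
  by apply: measurable_funM => //; exact: measurableT_comp mg measurable_fst.
have iF : (mu \x P)%E.-integrable setT F.
  apply/integrable21ltyP => //.
  apply: (@le_lt_trans _ _ (\int[P]_w (`|(Z w)%:E| * \int[mu]_l `|(g l)%:E|))%E).
    apply: ge0_le_integral => //.
    - by move=> w _; exact: integral_ge0.
    - apply: (@measurable_fun_fubini_tonelli_G _ _ _ _ _ mu (abse \o F)) => //=.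
      exact: measurableT_comp.
    - apply: emeasurable_funM; last exact: measurable_cst.
      by apply: measurableT_comp => //; exact: measurable_int iZ.
    move=> w _.
    rewrite -ge0_integralZl//; last first.
      by apply: measurableT_comp => //; exact: measurable_int ig.
    apply: ge0_le_integral => //.
    - apply: measurableT_comp => //; exact: (measurableT_comp mF (measurable_pair2 w)).
    - apply: measurable_funeM; apply: measurableT_comp => //; exact: measurable_int ig.
    move=> l _; rewrite /F/= -EFinM lee_fin !normrM ler_wpM2l//.
    by rewrite ler_piMl// indicE; case: (_ \in _); rewrite ?normr1 ?normr0.
  rewrite ge0_integralZr//; last 2 first.
  - by apply: measurableT_comp => //; exact: measurable_int iZ.
  - exact: integral_ge0.
  move/integrableP : iZ => [_ /= iZ]; move/integrableP : ig => [_ /= ig].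
  rewrite lte_mul_pinfty//; first exact: integral_ge0.
  by rewrite ge0_fin_numE// integral_ge0.
have F1 w : fubini_G mu F w = (Z w * Rintegral mu [set l | l <= D w] g)%:E.
  have mDw : measurable [set l | l <= D w].
    by rewrite -[X in measurable X]set_itvNyc.
  rewrite /fubini_G /F /Rintegral EFinM fineK; last first.
    by apply: integrable_fin_num => //; exact: (@integrableS _ _ _ mu setT).
  rewrite [in RHS]integral_mkcond -integralZl//; last first.
    apply: (iffLR (@integrable_mkcond _ _ _ mu _ (EFin \o g) mDw)).
    exact: (@integrableS _ _ _ mu setT).
  apply: eq_integral => l _; rewrite EFinM patchE indicE /S/=.
  (* Both memberships unfold to the same boolean, so one case analysis settles them. *)
  by rewrite -[(l, w) \in _]/(`[< l <= D w >]) -[l \in _]/(`[< l <= D w >]);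
    case: asboolP => _; rewrite ?mul1r ?mul0r.
have F2 l : fubini_F P F l = (Ex P (fun w => Z w * \1_(evDge D l) w) * g l)%:E.
  have mDl : measurable (evDge D l).
    by rewrite -[evDge D l]setTI; apply: measurable_fun_le.
  have iZl : P.-integrable setT (EFin \o (fun w => Z w * \1_(evDge D l) w)).
    apply: le_integrable iZ => //.
      by apply/measurable_EFinP/measurable_funM => //; exact: measurable_indic.
    move=> w _ /=; rewrite lee_fin normrM ler_piMr// indicE.
    by case: (_ \in _); rewrite ?normr1 ?normr0.
  rewrite /fubini_F /F EFinM /Ex fineK; last exact: integrable_fin_num.
  rewrite -integralZr//; apply: eq_integral => w _; rewrite -EFinM; congr EFin.
  by rewrite mulrA.
split.
  by have := integrable_fubini_F iF; apply: eq_integrable => // l _; exact: F2.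
have E2 : (\int[mu]_l fubini_F P F l =
    \int[mu]_l (Ex P (fun w => Z w * \1_(evDge D l) w) * g l)%:E)%E.
  by apply: eq_integral => l _; exact: F2.
have E1 : (\int[P]_w fubini_G mu F w =
    \int[P]_w (Z w * Rintegral mu [set l | l <= D w] g)%:E)%E.
  by apply: eq_integral => w _; exact: F1.
rewrite /Ex -E1 -E2 fineK.
  by rewrite integral12_prod_meas1// integral21_prod_meas1.
by rewrite integral21_prod_meas1//; exact: integrable_fin_num.
Qed.
End LayerCake.

(** * Calculus of C1 functions on a segment *)

Section C1.
Context {R : realType}.
Local Notation mu := (@lebesgue_measure R).
Implicit Types (a b d : R) (f : R -> R).

Lemma C1_on_subitv {a b d f} : a <= d <= b -> C1_on a b f -> C1_on a d f.
Proof.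
move=> /andP[ad db] [cf [df [f' [cf' f'E]]]].
have sub : `[a, d]%classic `<=` `[a, b]%classic.
  by apply: subset_itvl; rewrite bnd_simp.
have lt_db x : a < x < d -> a < x < b.
  by move=> /andP[-> xd] /=; exact: lt_le_trans db.
split; first exact: continuous_subspaceW cf.
split; first by move=> x /lt_db/df.
by exists f'; split; [exact: continuous_subspaceW cf'|move=> x /lt_db/f'E].
Qed.

(** [C1_on] does not control the two-sided [derive1 f] at the endpoints, hence the open interval.
    Inside, it agrees with [f'], which is continuous on a compact segment. *)
Lemma C1_on_integrable_derive1 {a b f} : a <= b -> C1_on a b f ->
  mu.-integrable `]a, b[ (EFin \o derive1 f).
Proof.
move=> ab [_ [_ [f' [cf' f'E]]]].
have if' : mu.-integrable `[a, b] (EFin \o f').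
  by apply: continuous_compact_integrable => //; exact: segment_compact.
apply: (@eq_integrable _ _ _ mu _ _ (EFin \o f')) => //.
  by move=> x; rewrite inE/= in_itv/= => /f'E ->.
by apply: (@integrableS _ _ _ mu `[a, b]) => //; exact: subset_itv_oo_cc.
Qed.

Lemma C1_on_measurable_derive1 {a b f} : a <= b -> C1_on a b f ->
  measurable_fun `]a, b[ (derive1 f).
Proof.
by move=> ab /(C1_on_integrable_derive1 ab)/measurable_int/measurable_EFinP.
Qed.

Lemma integral_derive1 {a b f} : a < b -> C1_on a b f ->
  (\int[mu]_(x in `]a, b[) (derive1 f x)%:E = (f b - f a)%:E)%E.
Proof.
move=> ab [cf [df [f' [cf' f'E]]]].
have [cfr cfl] : f x @[x --> a^'+] --> f a /\
  f x @[x --> b^'-] --> f b.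
  by have [_ ? ?] := (continuous_within_itvP _ ab).1 cf.
have dfab : derivable_oo_LRcontinuous f a b.
  by split => // x; rewrite in_itv/= => /df.
have f'in : {in `]a, b[, derive1 f =1 f'} by move=> x; rewrite in_itv/= => /f'E.
rewrite EFinB -(continuous_FTC2 ab cf' dfab f'in).
rewrite [RHS]integral_itv_bndoo; last first.
  apply/measurable_EFinP.
  apply: (@measurable_funS _ _ _ _ `[a, b]) => //; first exact: subset_itv_oo_cc.
  exact: subspace_continuous_measurable_fun.
by apply: eq_integral => x; rewrite inE/= in_itv/= => /f'E ->.
Qed.

(** Inner integral of the layer cake at dose [d]. The half-line up to [d] meets []a, b[] in nothing
    if [d = a], in []a, b[] if [d = b], and in []a, d]] otherwise; the fundamental theorem of
    calculus then applies. *)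
Lemma Rintegral_derive1_le {a b d f} : a < b -> a <= d <= b -> C1_on a b f ->
  Rintegral mu [set l | l <= d] (derive1 f \_ `]a, b[) = f d - f a.
Proof.
move=> ab adb cf.
rewrite -Rintegral_mkcondr.
have := adb => /andP[]; rewrite le_eqVlt => /predU1P[<-{d adb} _|ad db].
  rewrite subrr (_ : _ `&` _ = set0) ?Rintegral_set0//.
  apply/seteqP; split => // l [/= la]; rewrite in_itv/= => /andP[al _].
  by move: (lt_le_trans al la); rewrite ltxx.
have cfd := C1_on_subitv adb cf.
suff E : (\int[mu]_(l in [set l | (l <= d)%R] `&` `]a, b[) (derive1 f l)%:E =
    \int[mu]_(l in `]a, d[) (derive1 f l)%:E)%E.
  by rewrite /Rintegral E integral_derive1.
move: db; rewrite le_eqVlt => /predU1P[->|db].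
  congr (integral _ _ _); apply/seteqP; split => [l []//|l /= lab].
  by split => //=; move: lab; rewrite in_itv/= => /andP[_ /ltW].
rewrite (_ : _ `&` _ = `]a, d]%classic).
  rewrite integral_itv_bndoo//; apply/measurable_EFinP.
  exact: C1_on_measurable_derive1 (ltW ad) cfd.
apply/seteqP; split => l /=; rewrite !in_itv/=.
  by move=> [-> /andP[-> _]].
by move=> /andP[al ld]; rewrite al ld (le_lt_trans ld db).
Qed.

End C1.

(** The two endpoints form a null set, so whatever default [derive1] takes there is harmless. *)
Lemma integrable_itv_oo_cc {R : realType} {a b : R} {f : R -> R} :
  (@lebesgue_measure R).-integrable `]a, b[ (EFin \o f) ->
  (@lebesgue_measure R).-integrable `[a, b] (EFin \o f).
Proof.
move=> /integrableP[mf foo]; apply/integrableP; split.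
  exact: emeasurable_fun_itv_cc mf.
by rewrite integral_itv_bndoo//; exact: measurableT_comp.
Qed.

(** * Integrability, expectation, and the layer cake for C1 functions *)

Section Expectation.
Context {disp : measure_display} {Omega : measurableType disp} {R : realType}.
Variable P : probability Omega R.
Local Notation mu := (@lebesgue_measure R).
Local Notation integrable X := (P.-integrable setT (EFin \o X)).
Implicit Types (X Y Z D : Omega -> R) (A B : set Omega) (f g : R -> R).

(** The bound is asked only where [Z] is nonzero because the dose is bounded on the event of a
    treated group, which carries [Z]. *)
Lemma integrable_bounded_mul {Z h : Omega -> R} {M : R} :
  integrable Z -> measurable_fun setT h ->
  (forall w, Z w != 0 -> `|h w| <= M) -> integrable (fun w => Z w * h w).
Proof.
move=> iZ mh hM.
have mZ : measurable_fun setT Z.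
  by apply/measurable_EFinP; exact: measurable_int iZ.
apply: (@le_integrable _ _ _ P _ _ _ (fun w => M%:E * (Z w)%:E)%E) => //.
- by apply/measurable_EFinP; exact: measurable_funM.
- move=> w _ /=; rewrite lee_fin !normrM mulrC.
  have [->|Z0] := eqVneq (Z w) 0; first by rewrite normr0 !mulr0.
  by rewrite ler_wpM2r// (le_trans (hM _ Z0))// ler_norm.
- exact: integrableZl.
Qed.

Lemma integrable_mul_indic {Z A} : measurable A -> integrable Z ->
  integrable (fun w => Z w * \1_A w).
Proof.
move=> mA iZ; apply: (integrable_bounded_mul (M := 1)) => //.
by move=> w _; rewrite indicE; case: (_ \in _); rewrite ?normr1 ?normr0.
Qed.

Lemma integrable_scale {Z} c : integrable Z -> integrable (fun w => c * Z w).
Proof. by move=> iZ; exact: (@integrableZl _ _ _ P _ _ c (EFin \o Z)). Qed.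

Lemma integrable_sub {X Y} : integrable X -> integrable Y ->
  integrable (fun w => X w - Y w).
Proof. by move=> iX iY; exact: (@integrableB _ _ _ P _ _ (EFin \o X) (EFin \o Y)). Qed.

Lemma integrable_indic_prob {A} : measurable A -> integrable (\1_A : Omega -> R).
Proof. exact: integrable_indic. Qed.

Lemma Ex_sub {X Y} : integrable X -> integrable Y ->
  Ex P (fun w => X w - Y w) = Ex P X - Ex P Y.
Proof. by move=> iX iY; exact: RintegralB. Qed.

Lemma Ex_scale {X} c : integrable X -> Ex P (fun w => c * X w) = c * Ex P X.
Proof. by move=> iX; exact: RintegralZl. Qed.

Lemma Ex_indic A : measurable A -> Ex P \1_A = Pr P A.
Proof. by move=> mA; rewrite /Ex integral_indic// setIT. Qed.

Lemma Ex_ge0 X : (forall w, 0 <= X w) -> 0 <= Ex P X.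
Proof. by move=> X0; exact: Rintegral_ge0. Qed.

Lemma le_Ex {X Y} : integrable X -> integrable Y -> (forall w, X w <= Y w) ->
  Ex P X <= Ex P Y.
Proof. by move=> iX iY XY; apply: le_Rintegral => // w _; exact: XY. Qed.

Lemma Pr_gt0 A : measurable A -> (0 < P A)%E -> 0 < Pr P A.
Proof. by move=> mA A0; rewrite fine_gt0// A0 ltey_eq fin_num_measure. Qed.

(** Serves null tail events, on which [CE] divides by zero. *)
Lemma Ex_mul_indic_eq0 {Z A} : measurable A -> integrable Z -> Pr P A = 0 ->
  Ex P (fun w => Z w * \1_A w) = 0.
Proof.
move=> mA iZ A0.
have PA0 : P A = 0%E.
  by rewrite -[LHS]fineK ?fin_num_measure//; congr EFin.
rewrite /Ex (_ : (\int[P]_w _)%E = 0%E)//.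
transitivity (\int[P]_(w in A) (Z w)%:E)%E.
  rewrite [RHS]integral_mkcond; apply: eq_integral => w _.
  by rewrite patchE indicE; case: (_ \in _); rewrite ?mulr1 ?mulr0.
apply: null_set_integral => //.
by apply: (@measurable_funS _ _ _ _ setT) => //; exact: measurable_int iZ.
Qed.

(** The general layer cake is applied to the derivative of [f] set to zero outside the open
    interval. *)
Lemma layer_cake_C1 Z D a b f : a < b ->
  integrable Z -> measurable_fun setT D ->
  (forall w, Z w != 0 -> a <= D w <= b) -> C1_on a b f ->
  mu.-integrable `[a, b]
    (fun l => (Ex P (fun w => Z w * \1_(evDge D l) w) * derive1 f l)%:E) /\
  (\int[mu]_(l in `[a, b])
     (Ex P (fun w => Z w * \1_(evDge D l) w) * derive1 f l)%:E =
   (Ex P (fun w => (Z w * (f (D w) - f a))%R))%:E)%E.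
Proof.
move=> ab iZ mD Dab cf.
have ig : mu.-integrable setT (EFin \o (derive1 f \_ `]a, b[)).
  rewrite -restrict_EFin; apply: (iffLR (@integrable_mkcond _ _ _ mu _ _ _)) => //.
  exact: C1_on_integrable_derive1 (ltW ab) cf.
have [iL EL] := layer_cake P Z D _ iZ mD ig.
pose L l := Ex P (fun w => Z w * \1_(evDge D l) w) * derive1 f l.
have LE l : (Ex P (fun w => Z w * \1_(evDge D l) w) *
    (derive1 f \_ `]a, b[) l)%:E = ((EFin \o L) \_ `]a, b[) l.
  by rewrite !patchE; case: ifP => // _; rewrite mulr0.
have iLoo : mu.-integrable `]a, b[ (EFin \o L).
  apply: (iffRL (@integrable_mkcond _ _ _ mu _ _ _)) => //.
  by apply: eq_integrable iL => // l _; exact: LE.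
split; first exact: integrable_itv_oo_cc iLoo.
rewrite integral_itv_bndoo; last exact: measurable_int iLoo.
rewrite integral_mkcond.
transitivity (\int[mu]_l (Ex P (fun w => Z w * \1_(evDge D l) w) *
    (derive1 f \_ `]a, b[) l)%:E)%E; first by apply: eq_integral => l _; rewrite LE.
rewrite EL; congr (Ex P _)%:E; apply/funext => w.
have [->|/Dab Dw] := eqVneq (Z w) 0; first by rewrite !mul0r.
by rewrite (Rintegral_derive1_le ab Dw cf).
Qed.

End Expectation.

Lemma indic_neq0 {T : Type} {R : realType} (A : set T) (w : T) :
  (\1_A w : R) != 0 -> A w.
Proof.
by rewrite indicE; case: (boolP (w \in A)) => [/set_mem//|_]; rewrite eqxx.
Qed.

Lemma indic_eq1 {T : Type} {R : realType} (A : set T) (w : T) :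
  A w -> \1_A w = 1 :> R.
Proof. by move=> Aw; rewrite indicE mem_set. Qed.

Lemma C1_on_id {R : realType} (a b : R) : C1_on a b id.
Proof.
split; first by apply: continuous_subspaceT => x; exact: cvg_id.
split; first by move=> x _; exact: derivable_id.
exists (cst 1); split; first by apply: continuous_subspaceT => x; exact: cvg_cst.
by move=> x _; rewrite derive1E derive_id.
Qed.

Lemma measurable_near {d : measure_display} {T : measurableType d} {R : realType}
  (X : T -> R) (x e : R) : measurable_fun setT X ->
  measurable [set w | (`|X w - x| < e)%R].
Proof.
move=> mX.
have mh : measurable_fun setT (fun w => `|X w - x|).
  by apply: measurableT_comp => //; exact: measurable_funB.
have := mh measurableT `]-oo, e[%classic (measurable_itv _).
by rewrite setTI (_ : _ @^-1` _ = [set w | `|X w - x| < e]).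
Qed.

(** * Dose tails, covariance and variance within one timing group *)

Section Conditional.
Context {disp : measure_display} {Omega : measurableType disp} {R : realType}.
Variable P : probability Omega R.
Variables (G : Omega -> nat) (D : Omega -> R) (g : nat) (a b : R).
Local Notation mu := (@lebesgue_measure R).
Local Notation integrable X := (P.-integrable setT (EFin \o X)).
Local Notation A := (evG G g).
Local Notation p := (Pr P A).
Local Notation c := (CE P D A).
Hypotheses (mA : measurable A) (p_gt0 : 0 < p).
Hypotheses (mD : measurable_fun setT D) (ab : a < b).
Hypothesis Dab : forall w, A w -> a <= D w <= b.
Implicit Types (X Z : Omega -> R) (f m : R -> R).

Let p_neq0 : p != 0. Proof. by rewrite gt_eqF. Qed.

Let mDge l : measurable (evDge D l).
Proof. by rewrite -[evDge D l]setTI; apply: measurable_fun_le. Qed.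

Let D_le w : A w -> `|D w| <= Num.max `|a| `|b|.
Proof.
move=> /Dab /andP[aD Db]; rewrite le_max.
have [D0|D0] := leP 0 (D w); apply/orP; [right|left].
  by rewrite ger0_norm// (le_trans Db)// ler_norm.
by rewrite ltr0_norm// -[leRHS]normrN (le_trans _ (ler_norm _))// lerN2.
Qed.

Lemma integrable_dose : integrable (fun w => D w * \1_A w).
Proof.
rewrite (_ : (fun w => _) = fun w => \1_A w * D w); last first.
  by apply/funext => w; rewrite mulrC.
apply: (integrable_bounded_mul P (integrable_indic_prob P mA) mD).
by move=> w /(indic_neq0 _ w) Aw; exact: D_le.
Qed.

(** Makes the total mass of the weights a special case of the decompositions: the derivative of [id]
    is 1, so only the weight is left under the integral. *)
Lemma reg_fun_id : reg_fun P G D g D id.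
Proof. by split; [exact: measurable_id|split; [exact: integrable_dose|]]. Qed.

Lemma CE_mul X : Ex P (fun w => X w * \1_A w) = CE P X A * p.
Proof. by rewrite /CE divfK. Qed.

Lemma reg_fun_Ex {X m} : reg_fun P G D g X m ->
  Ex P (fun w => m (D w) * \1_A w) = CE P X A * p.
Proof.
move=> [_ [_ /(_ setT measurableT)]]; rewrite preimage_setT setIT => <-.
exact: CE_mul.
Qed.

Lemma condPr_tail l :
  condPr P (evDge D l) A = p^-1 * Ex P (fun w => \1_A w * \1_(evDge D l) w).
Proof.
rewrite /condPr mulrC setIC -(Ex_indic P (A `&` evDge D l)); last exact: measurableI.
by rewrite indicI.
Qed.

(** Here [f] need not be the regression of group [g]: comparing two groups requires the dose tail of
    one against the regression slope of the other. *)
Lemma integral_condPr_C1 {f} : C1_on a b f ->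
  mu.-integrable `[a, b]
    (fun l => (condPr P (evDge D l) A * derive1 f l)%:E) /\
  (\int[mu]_(l in `[a, b]) (condPr P (evDge D l) A * derive1 f l)%:E =
   (p^-1 * Ex P (fun w => \1_A w * (f (D w) - f a)))%:E)%E.
Proof.
move=> cf.
have [iL EL] : _ /\ _ := layer_cake_C1 P \1_A D a b f ab
  (integrable_indic_prob P mA) mD (fun w Aw => Dab w (indic_neq0 A w Aw)) cf.
have E l : (condPr P (evDge D l) A * derive1 f l)%:E =
    (p^-1%:E * (Ex P (fun w => \1_A w * \1_(evDge D l) w) * derive1 f l)%:E)%E.
  by rewrite condPr_tail -EFinM mulrA.
split.
  by apply: (eq_integrable _ _ _ _ (integrableZl _ p^-1 iL)) => // l _; rewrite E.
under eq_integral do rewrite E.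
by rewrite integralZl// EL -EFinM.
Qed.

Lemma integral_condPr_reg_fun {X m} : reg_fun P G D g X m -> C1_on a b m ->
  (\int[mu]_(l in `[a, b]) (condPr P (evDge D l) A * derive1 m l)%:E =
   (CE P X A - m a)%:E)%E.
Proof.
move=> rm cm; have [_ ->] := integral_condPr_C1 cm; congr EFin.
rewrite (_ : (fun w => _) = fun w => m (D w) * \1_A w - m a * \1_A w); last first.
  by apply/funext => w; ring.
rewrite Ex_sub; last 2 first.
- by have [_ [? _]] := rm.
- by apply: integrable_scale; exact: integrable_indic_prob.
rewrite (reg_fun_Ex rm) Ex_scale; last exact: integrable_indic_prob.
by rewrite Ex_indic//; field.
Qed.

(** [reg_fun] tests only against indicators of dose sets; the layer cake writes the factor [D] as a
    superposition of such indicators. *)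
Lemma reg_fun_mul_dose {X m} : integrable X -> reg_fun P G D g X m ->
  Ex P (fun w => X w * \1_A w * D w) = Ex P (fun w => m (D w) * \1_A w * D w).
Proof.
move=> iX rm; have [mm [im rE]] := rm.
have tail Z : integrable (fun w => Z w * \1_A w) ->
    Ex P (fun w => Z w * \1_A w * D w) - a * Ex P (fun w => Z w * \1_A w) =
    fine (\int[mu]_(l in `[a, b])
      (Ex P (fun w => Z w * \1_A w * \1_(evDge D l) w) * derive1 id l)%:E)%E.
  move=> iZ.
  have ZA w : Z w * \1_A w != 0 -> A w.
    by rewrite mulf_eq0 negb_or => /andP[_]; exact: indic_neq0.
  have [_ ->] := layer_cake_C1 P _ D a b id ab iZ mD
    (fun w Zw => Dab w (ZA w Zw)) (C1_on_id a b).
  rewrite (_ : (fun w => Z w * \1_A w * (D w - a)) =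
    fun w => Z w * \1_A w * D w - a * (Z w * \1_A w)); last first.
    by apply/funext => w; ring.
  rewrite /= Ex_sub ?Ex_scale//; last exact: integrable_scale.
  apply: (integrable_bounded_mul P (M := Num.max `|a| `|b|) iZ mD) => w /ZA Aw.
  exact: D_le.
have iXA := integrable_mul_indic P mA iX.
have := tail (m \o D) im; have := tail X iXA.
(* Both expectations multiplied by [a] become [CE P X A * p], so these terms cancel at the end. *)
rewrite (reg_fun_Ex rm) CE_mul.
under eq_integral => l _.
  rewrite (_ : Ex P _ = Ex P (fun w => m (D w) * \1_A w * \1_(evDge D l) w)).
    over.
  (* The tail expectations agree by testing the regression on the half-line from [l]. *)
  have := rE `[l, +oo[%classic (measurable_itv _).
  rewrite (_ : D @^-1` _ = evDge D l); last first.
    by apply/seteqP; split => w /=; rewrite in_itv/= andbT.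
  rewrite indicI => E; rewrite -[RHS]/(Ex P _).
  by under eq_fun do rewrite -mulrA; rewrite E; under eq_fun do rewrite mulrA.
by move=> <- /addIr.
Qed.

Lemma integrable_dev : integrable (fun w => (D w - c) * \1_A w).
Proof.
rewrite (_ : (fun w => _) = fun w => D w * \1_A w - c * \1_A w); last first.
  by apply/funext => w; ring.
apply: integrable_sub integrable_dose _.
by apply: integrable_scale; exact: integrable_indic_prob.
Qed.

Lemma Ex_dev : Ex P (fun w => (D w - c) * \1_A w) = 0.
Proof.
rewrite (_ : (fun w => _) = fun w => D w * \1_A w - c * \1_A w); last first.
  by apply/funext => w; ring.
rewrite Ex_sub; [|exact: integrable_dose|].
  rewrite Ex_scale ?Ex_indic ?CE_mul ?subrr//; exact: integrable_indic_prob.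
by apply: integrable_scale; exact: integrable_indic_prob.
Qed.

(** The tail probability clears the denominator of the mean conditional on the tail, leaving an
    unconditional expectation to which the layer cake applies. *)
Lemma dev_tail l :
  (CE P D (A `&` evDge D l) - c) * condPr P (evDge D l) A =
  p^-1 * Ex P (fun w => (D w - c) * \1_A w * \1_(evDge D l) w).
Proof.
have mB : measurable (A `&` evDge D l) by exact: (measurableI _ _ mA (mDge l)).
have E : (fun w => (D w - c) * \1_A w * \1_(evDge D l) w) =
   fun w => D w * \1_(A `&` evDge D l) w - c * \1_(A `&` evDge D l) w.
  by apply/funext => w; rewrite indicI /=; ring.
have iDB : integrable (fun w => D w * \1_(A `&` evDge D l) w).
  rewrite (_ : (fun w => _) = fun w => D w * \1_A w * \1_(evDge D l) w).
    exact: integrable_mul_indic integrable_dose.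
  by apply/funext => w; rewrite indicI/= mulrA.
have iB := integrable_indic_prob P mB.
rewrite E Ex_sub ?Ex_scale ?Ex_indic//; last exact: integrable_scale.
rewrite /condPr [in Pr P (evDge _ _ `&` _)]setIC [CE P D (A `&` _)]/CE.
(* On a null tail the left side vanishes with its probability factor, and the right side because it
   integrates over a null event. *)
have [q0|q0] := eqVneq (Pr P (A `&` evDge D l)) 0; last by field; rewrite p_neq0.
rewrite q0 mul0r mulr0 mulr0 subr0.
have := Ex_mul_indic_eq0 P mB integrable_dose q0.
rewrite (_ : (fun w => _) = fun w => D w * \1_(A `&` evDge D l) w).
  by move=> ->; rewrite mulr0.
apply/funext => w; rewrite indicI/=.
have [->|/(indic_neq0 _ w) Aw] := eqVneq (\1_A w : R) 0;
  first by rewrite !(mul0r, mulr0).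
by rewrite indic_eq1// mulr1.
Qed.

(** If [c <= l], the integrand is nonnegative. If [l < c], cutting to the tail discards only
    nonpositive values from a deviation of mean zero. *)
Lemma dev_tail_ge0 l : 0 <= Ex P (fun w => (D w - c) * \1_A w * \1_(evDge D l) w).
Proof.
have [cl|lc] := leP c l.
  apply: Ex_ge0 => w; rewrite -mulrA.
  have [->|/(indic_neq0 _ w) Dl] := eqVneq (\1_(evDge D l) w : R) 0;
  first by rewrite !mulr0.
  rewrite mulr_ge0 ?mulr_ge0 ?ler0n// subr_ge0; exact: le_trans Dl.
rewrite -Ex_dev; apply: le_Ex; first exact: integrable_dev.
  exact: integrable_mul_indic integrable_dev.
move=> w; rewrite [\1_(evDge D l) w]indicE; case: (boolP (w \in _)) => [|/negP Dl].
  by rewrite mulr1.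
rewrite mulr0 mulr_le0_ge0 ?ler0n// subr_le0 (le_trans _ (ltW lc))// leNgt.
by apply/negP => /ltW lD; apply: Dl; rewrite inE.
Qed.

(** Centring [D] alone suffices, since its deviation has mean zero on the group. *)
Lemma ccov_dose X : integrable X ->
  ccov P X D A = p^-1 * Ex P (fun w => X w * \1_A w * D w) - CE P X A * c.
Proof.
move=> iX; have iXA := integrable_mul_indic P mA iX.
have iXD : integrable (fun w => X w * \1_A w * D w).
  apply: (integrable_bounded_mul P (M := Num.max `|a| `|b|) iXA mD) => w.
  by rewrite mulf_eq0 negb_or => /andP[_] /(indic_neq0 _ w) Aw; exact: D_le.
rewrite /ccov {1}/CE.
rewrite (_ : (fun w => _) = fun w => (X w * \1_A w * D w - c * (X w * \1_A w))
  - CE P X A * ((D w - c) * \1_A w)); last by apply/funext => w; ring.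
have iD := integrable_dev.
rewrite Ex_sub; last 2 first.
- by apply: integrable_sub => //; exact: integrable_scale.
- exact: integrable_scale.
rewrite Ex_sub//; last exact: integrable_scale.
by rewrite !Ex_scale// Ex_dev CE_mul; field.
Qed.

(** Layer cake with the dose deviation as multiplier: the constant [m a] drops out since the
    deviation has mean zero, and [reg_fun_mul_dose] exchanges [m (D w)] for [X w]. *)
Lemma integral_dev_tail {X m} : integrable X -> reg_fun P G D g X m ->
  C1_on a b m ->
  mu.-integrable `[a, b]
    (fun l => ((CE P D (A `&` evDge D l) - c) * condPr P (evDge D l) A
               * derive1 m l)%:E) /\
  (\int[mu]_(l in `[a, b])
     ((CE P D (A `&` evDge D l) - c) * condPr P (evDge D l) A
      * derive1 m l)%:E = (ccov P X D A)%:E)%E.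
Proof.
move=> iX rm cm; have [mm [im _]] := rm.
have devA w : (D w - c) * \1_A w != 0 -> A w.
  by rewrite mulf_eq0 negb_or => /andP[_]; exact: indic_neq0.
have [iL EL] : _ /\ _ := layer_cake_C1 P _ D a b m ab
  integrable_dev mD (fun w Aw => Dab w (devA w Aw)) cm.
have E l : ((CE P D (A `&` evDge D l) - c) * condPr P (evDge D l) A
      * derive1 m l)%:E = (p^-1%:E *
    (Ex P (fun w => (D w - c) * \1_A w * \1_(evDge D l) w) * derive1 m l)%:E)%E.
  by rewrite dev_tail -EFinM mulrA.
split.
  by apply: (eq_integrable _ _ _ _ (integrableZl _ p^-1 iL)) => // l _; rewrite E.
under eq_integral do rewrite E.
rewrite integralZl// EL -EFinM; congr EFin.
rewrite ccov_dose// (reg_fun_mul_dose iX rm).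
have imD : integrable (fun w => m (D w) * \1_A w * D w).
  apply: (integrable_bounded_mul P (M := Num.max `|a| `|b|) im mD) => w.
  by rewrite mulf_eq0 negb_or => /andP[_] /(indic_neq0 _ w) Aw; exact: D_le.
have iD := integrable_dev.
rewrite (_ : (fun w => _) = fun w =>
  (m (D w) * \1_A w * D w - c * (m (D w) * \1_A w))
  - m a * ((D w - c) * \1_A w)); last by apply/funext => w; ring.
rewrite Ex_sub; last 2 first.
- by apply: integrable_sub => //; exact: integrable_scale.
- exact: integrable_scale.
rewrite Ex_sub//; last exact: integrable_scale.
by rewrite !Ex_scale// Ex_dev (reg_fun_Ex rm); field.
Qed.

(** A Chebyshev bound: the dose charges every neighbourhood of some point other than its mean. *)
Lemma cvar_gt0 :
  (forall x, a <= x <= b -> forall e, 0 < e ->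
     (0 < P (A `&` [set w | (`|D w - x| < e)%R]))%E) ->
  0 < cvar P D A.
Proof.
move=> supp.
(* At least one end of the segment differs from the mean. *)
have [x xab xc] : exists2 x, a <= x <= b & x != c.
  have [ac|ac] := eqVneq a c; last by exists a; rewrite // lexx ltW.
  by exists b; rewrite ?lexx ?ltW// -ac gt_eqF.
(* Half the distance: within [e] of [x], the triangle inequality puts [D] at distance more than [e]
   from [c]. *)
pose e := `|x - c| / 2.
have e0 : 0 < e by rewrite divr_gt0// normr_gt0 subr_eq0.
set B := [set w | (`|D w - x| < e)%R].
have mB : measurable (A `&` B).
  by apply: measurableI => //; exact: measurable_near.
have q0 := Pr_gt0 P _ mB (supp _ xab _ e0).
rewrite /cvar /ccov {1}/CE divr_gt0//.
apply: (@lt_le_trans _ _ (e ^+ 2 * Pr P (A `&` B))).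
  by rewrite mulr_gt0// exprn_gt0.
rewrite -Ex_indic// -Ex_scale; last exact: integrable_indic_prob.
apply: le_Ex.
- by apply: integrable_scale; exact: integrable_indic_prob.
- rewrite (_ : (fun w => _) = fun w => (D w - c) * \1_A w * (D w - c)); last first.
    by apply/funext => w; ring.
  apply: (integrable_bounded_mul P (M := Num.max `|a| `|b| + `|c|) integrable_dev).
    exact: measurable_funB.
  move=> w; rewrite mulf_eq0 negb_or => /andP[_] /(indic_neq0 _ w) Aw.
  have Dw := D_le _ Aw.
  by rewrite (le_trans (ler_normB _ _))// lerD2r.
move=> w; rewrite indicI/= -[(D w - c) * _]/((D w - c) ^+ 2).
have [->|/(indic_neq0 _ w) Aw] := eqVneq (\1_A w : R) 0;
  first by rewrite mul0r !mulr0.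
rewrite mulrCA mulrC ler_wpM2r ?ler0n//.
have [->|/(indic_neq0 _ w)/= Bw] := eqVneq (\1_B w : R) 0;
  first by rewrite mulr0 sqr_ge0.
rewrite (indic_eq1 _ w Bw) mulr1 -[leRHS]real_normK ?num_real//.
rewrite ler_pXn2r ?nnegrE ?(ltW e0)//.
have : `|x - c| <= `|D w - c| + `|D w - x|.
  by rewrite (_ : x - c = (D w - c) - (D w - x)) ?ler_normB//; ring.
rewrite (_ : `|x - c| = e * 2); last by rewrite /e; field.
have {}Bw : `|D w - x| < e by [].
by move: Bw; clearbody e; lra.
Qed.

(** With [a = dL > 0], keeps the denominators of [w1] and [w0] positive. *)
Lemma CE_dose_ge : a <= c.
Proof.
rewrite /CE ler_pdivlMr// -Ex_indic// -Ex_scale; last exact: integrable_indic_prob.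
apply: le_Ex; [|exact: integrable_dose|].
  by apply: integrable_scale; exact: integrable_indic_prob.
move=> w; have [->|/(indic_neq0 _ w) Aw] := eqVneq (\1_A w : R) 0.
  by rewrite !mulr0.
by rewrite ler_wpM2r ?ler0n//; have /andP[] := Dab _ Aw.
Qed.

End Conditional.

(** * Linear combinations of integrals with known values *)

Lemma integral_scalel {R : realType} {a b : R} {F : R -> R} (s v : R) :
  (@lebesgue_measure R).-integrable `[a, b] (EFin \o F) ->
  (\int[@lebesgue_measure R]_(l in `[a, b]) (F l)%:E = v%:E)%E ->
  (\int[@lebesgue_measure R]_(l in `[a, b]) (s * F l)%:E = (s * v)%:E)%E.
Proof.
move=> iF EF; under eq_integral do rewrite EFinM.
by rewrite integralZl// EF EFinM.
Qed.

Lemma integral_scale_sub {R : realType} {a b : R} {F H : R -> R} (s u v : R) :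
  (@lebesgue_measure R).-integrable `[a, b] (EFin \o F) ->
  (@lebesgue_measure R).-integrable `[a, b] (EFin \o H) ->
  (\int[@lebesgue_measure R]_(l in `[a, b]) (F l)%:E = u%:E)%E ->
  (\int[@lebesgue_measure R]_(l in `[a, b]) (H l)%:E = v%:E)%E ->
  (\int[@lebesgue_measure R]_(l in `[a, b]) (s * (F l - H l))%:E
   = (s * (u - v))%:E)%E.
Proof.
move=> iF iH EF EH; apply: (integral_scalel (F := fun l => F l - H l)).
  by apply: eq_integrable (integrableB _ iF iH).
under eq_integral do rewrite EFinB.
by rewrite integralB_EFin// EF EH EFinB.
Qed.

(** * Window averages and their conditional means *)

Section Windows.
Context {disp : measure_display} {Omega : measurableType disp} {R : realType}.
Variable P : probability Omega R.
Local Notation integrable X := (P.-integrable setT (EFin \o X)).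
Implicit Types (X : Omega -> R) (Y : nat -> Omega -> R) (A : nat * nat).

Lemma integrable_of_sqr X : measurable_fun setT X ->
  integrable (fun w => X w ^+ 2) -> integrable X.
Proof.
move=> mX iX2.
have i1 : integrable (cst 1 : Omega -> R) by exact: finite_measure_integrable_cst.
apply: (@le_integrable _ _ _ P _ _ _ (EFin \o (fun w => 1 + X w ^+ 2))) => //.
- exact/measurable_EFinP.
- move=> w _ /=; rewrite lee_fin [leRHS]ger0_norm ?addr_ge0 ?sqr_ge0//.
  (* The dominating inequality is [|x| <= 1 + x ^+ 2]. *)
  by rewrite ler_norml; apply/andP; split; nra.
- exact: (@integrableD _ _ _ P _ _ (EFin \o cst 1) (EFin \o (fun w => X w ^+ 2))).
Qed.

Lemma integrable_Ybar Y A :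
  (forall t, (A.1 <= t <= A.2)%N -> integrable (Y t)) -> integrable (Ybar Y A).
Proof.
move=> iY.
rewrite (_ : Ybar Y A = fun w => (A.2.+1 - A.1)%:R^-1 *
    \sum_(A.1 <= t < A.2.+1 | (A.1 <= t <= A.2)%N) Y t w); last first.
  by apply/funext => w; rewrite /Ybar mulrC big_nat.
apply: integrable_scale; rewrite (_ : EFin \o _ = fun w =>
    (\sum_(A.1 <= t < A.2.+1 | (A.1 <= t <= A.2)%N) (Y t w)%:E)%E); last first.
  by apply/funext => w /=; rewrite sumEFin.
exact: integrable_sum.
Qed.

Lemma CE_sub X1 X2 (B : set Omega) : measurable B ->
  integrable X1 -> integrable X2 ->
  CE P (fun w => X1 w - X2 w) B = CE P X1 B - CE P X2 B.
Proof.
move=> mB i1 i2; rewrite /CE -mulrBl -Ex_sub; first last.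
- exact: integrable_mul_indic.
- exact: integrable_mul_indic.
by congr (Ex P _ / _); apply/funext => w; rewrite mulrBl.
Qed.

(** The untreated mean subtracted in [piD] is constant in the dose. *)
Lemma derive1_piD Y (D : Omega -> R) A B m :
  derive1 (piD P Y D A B m) = derive1 m.
Proof.
apply/funext => x; rewrite /derive1.
rewrite (_ : (fun h => _) = fun h : R => h^-1 *: (m (h + x) - m x))//.
by apply/funext => h; congr (_ *: _); rewrite /piD opprB addrA subrK.
Qed.

End Windows.

(** * The four decompositions and the properties of their weights *)

Theorem theorem5
  (disp : measure_display) (Omega : measurableType disp) (R : realType)
  (P : probability Omega R)
  (TT : nat) (Gset : pred nat)
  (G : Omega -> nat) (D : Omega -> R)
  (Ypo : nat -> nat -> R -> Omega -> R)
  (dL dU : R)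
  (* setup: G takes values in Gset, a subset of {2,...,TT+1} *)
  (HGset : forall g, Gset g -> (2 <= g <= TT.+1)%N)
  (HGw : forall w, Gset (G w))
  (HGmeas : forall g, measurable (evG G g))
  (HDmeas : measurable_fun setT D)
  (* D = 0 for never treated, D in D_+ = [dL,dU] for G <= TT *)
  (HGD : forall w, (G w = TT.+1 -> D w = 0) /\ ((G w <= TT)%N -> dL <= D w <= dU))
  (* observed outcomes: measurable with finite second moments *)
  (HY : forall t, (1 <= t <= TT)%N ->
     measurable_fun setT (Yobs TT Ypo G D t) /\
     P.-integrable setT (fun w => ((Yobs TT Ypo G D t w) ^+ 2)%:E))
  (* 2-MP (a) *)
  (H2a_supp : forall x, in_support P D x <-> (x = 0 \/ dL <= x <= dU))
  (H2a_D0 : (0 < P (evD0 D))%E)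
  (H2a_cond : forall g, Gset g -> (g <= TT)%N -> forall x, dL <= x <= dU ->
     forall e : R, 0 < e -> (0 < P (evG G g `&` [set w | (`|D w - x| < e)%R]))%E)
  (* 2-MP (b) *)
  (H2b : 0 < dL < dU)
  (* 2-MP (c) *)
  (H2c : forall g, Gset g -> (g <= TT)%N -> forall t, (2 <= t <= TT)%N ->
     exists m : R -> R,
       reg_fun P G D g (fun w => Yobs TT Ypo G D t w - Yobs TT Ypo G D t.-1 w) m
       /\ C1_on dL dU m)
  (* 3-MP (a): no anticipation *)
  (H3a : forall t g (d : R) w, Gset g -> 0 <= d -> (t < g)%N -> Ypo t g d w = Ypo t TT.+1 0 w)
  (* 3-MP (b): staggered adoption *)
  (H3b : forall w, Wtr G D 1 w = 0 /\
     forall t d, (2 <= t <= TT)%N -> dL <= d <= dU ->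
       Wtr G D t.-1 w = d -> Wtr G D t w = d) :
  forall g k, Gset g -> Gset k -> (g < k)%N -> (k <= TT)%N ->
  [/\
   (* delta^WITHIN *)
   (forall m, reg_fun P G D g (Wdiff (Yobs TT Ypo G D) (POST TT g) (PRE g)) m ->
     C1_on dL dU m ->
     ((deltaWithin P (Yobs TT Ypo G D) G D TT g)%:E =
     \int[@lebesgue_measure R]_(l in `[dL, dU])
        (w1within P G D g l *
         derive1 (piD P (Yobs TT Ypo G D) D (POST TT g) (PRE g) m) l)%:E)%E),
   (* delta^{MID,PRE} *)
   (forall m, reg_fun P G D g (Wdiff (Yobs TT Ypo G D) (MID g k) (PRE g)) m ->
     C1_on dL dU m ->
     (deltaMidPre P (Yobs TT Ypo G D) G D g k)%:E =
     (\int[@lebesgue_measure R]_(l in `[dL, dU])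
        (w1 P G D g l *
         derive1 (piD P (Yobs TT Ypo G D) D (MID g k) (PRE g) m) l)%:E
      + (w0 P G D dL g * (piD P (Yobs TT Ypo G D) D (MID g k) (PRE g) m dL / dL)
         - w0 P G D dL g * (piG P (Yobs TT Ypo G D) G D (MID g k) (PRE g) k / dL))%:E)%E),
   (* delta^{POST,MID} *)
   (forall m, reg_fun P G D k (Wdiff (Yobs TT Ypo G D) (POST TT k) (MID g k)) m ->
     C1_on dL dU m ->
     (deltaPostMid P (Yobs TT Ypo G D) G D TT g k)%:E =
     (\int[@lebesgue_measure R]_(l in `[dL, dU])
        (w1 P G D k l *
         derive1 (piD P (Yobs TT Ypo G D) D (POST TT k) (MID g k) m) l)%:E
      + (w0 P G D dL k * (piD P (Yobs TT Ypo G D) D (POST TT k) (MID g k) m dL / dL)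
         - w0 P G D dL k *
           ((piG P (Yobs TT Ypo G D) G D (POST TT k) (PRE g) g
             - piG P (Yobs TT Ypo G D) G D (MID g k) (PRE g) g) / dL))%:E)%E),
   (* delta^{POST,PRE} *)
   (CE P D (evG G g) != CE P D (evG G k) ->
    forall mg mk,
     reg_fun P G D g (Wdiff (Yobs TT Ypo G D) (POST TT k) (PRE g)) mg -> C1_on dL dU mg ->
     reg_fun P G D k (Wdiff (Yobs TT Ypo G D) (POST TT k) (PRE g)) mk -> C1_on dL dU mk ->
     (deltaPostPre P (Yobs TT Ypo G D) G D TT g k)%:E =
     (\int[@lebesgue_measure R]_(l in `[dL, dU])
        (w1across P G D g k l *
         derive1 (piD P (Yobs TT Ypo G D) D (POST TT k) (PRE g) mg) l)%:E
      - (\int[@lebesgue_measure R]_(l in `[dL, dU])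
           (tw1across P G D g k l *
            (derive1 (piD P (Yobs TT Ypo G D) D (POST TT k) (PRE g) mk) l
             - derive1 (piD P (Yobs TT Ypo G D) D (POST TT k) (PRE g) mg) l))%:E
         + (tw0across P G D dL g k *
            ((piD P (Yobs TT Ypo G D) D (POST TT k) (PRE g) mk dL
              - piD P (Yobs TT Ypo G D) D (POST TT k) (PRE g) mg dL) / dL))%:E))%E) &
   (* properties of the weights (for both treated groups g and k) *)
   ((forall h, h = g \/ h = k ->
      [/\ forall l, dL <= l <= dU -> 0 <= w1within P G D h l /\ 0 <= w1 P G D h l,
          0 <= w0 P G D dL h,
          (\int[@lebesgue_measure R]_(l in `[dL, dU]) (w1within P G D h l)%:E = 1)%E &
          (\int[@lebesgue_measure R]_(l in `[dL, dU]) (w1 P G D h l)%:E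
           + (w0 P G D dL h)%:E = 1)%E]) /\
    (CE P D (evG G g) != CE P D (evG G k) ->
      (\int[@lebesgue_measure R]_(l in `[dL, dU]) (w1across P G D g k l)%:E = 1)%E))].
Proof.
move=> g k Gg Gk gk kT.
have gT : (g <= TT)%N by exact: ltnW (leq_trans gk kT).
have /andP[g2 _] := HGset g Gg; have /andP[k2 _] := HGset k Gk.
have [dL0 ab] : 0 < dL /\ dL < dU by apply/andP.
have dLn0 : dL != 0 by rewrite gt_eqF.
set Y := Yobs TT Ypo G D in HY H2c *.
have mD0 : measurable (evD0 D).
  by rewrite -[evD0 D]setTI; exact: (HDmeas measurableT [set 0] (measurable_set1 _)).
have iY t : (1 <= t <= TT)%N -> P.-integrable setT (EFin \o Y t).
  by move=> /HY[mY iY2]; exact: integrable_of_sqr.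
have iYb A : (1 <= A.1)%N -> (A.2 <= TT)%N ->
    P.-integrable setT (EFin \o Ybar Y A).
  move=> A1 A2; apply: integrable_Ybar => t /andP[At tA]; apply: iY.
  by rewrite (leq_trans A1 At) (leq_trans tA A2).
have iPOST h : (2 <= h)%N -> P.-integrable setT (EFin \o Ybar Y (POST TT h)).
  by move=> h2; apply: iYb => //=; exact: ltnW.
have iPRE : P.-integrable setT (EFin \o Ybar Y (PRE g)).
  by apply: iYb => //=; exact: leq_trans (leq_pred g) gT.
have iMID : P.-integrable setT (EFin \o Ybar Y (MID g k)).
  by apply: iYb => /=; [exact: ltnW|exact: leq_trans (leq_pred k) kT].
have Dab h : Gset h -> (h <= TT)%N -> forall w, evG G h w -> dL <= D w <= dU.
  by move=> _ hT w Gw; apply: (HGD w).2; rewrite (Gw : G w = h).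
have p0 h : Gset h -> (h <= TT)%N -> 0 < Pr P (evG G h).
  move=> Gh hT; apply: Pr_gt0 => //.
  have dLab : dL <= dL <= dU by rewrite lexx ltW.
  (* Any point of the dose support and any radius would do: the neighbourhood event lies inside the
     group. *)
  apply: lt_le_trans (H2a_cond h Gh hT dL dLab 1 ltr01) _.
  apply: le_measure; rewrite ?inE//.
  by apply: measurableI => //; exact: measurable_near.
have c0 h : Gset h -> (h <= TT)%N -> 0 < CE P D (evG G h).
  move=> Gh hT; apply: lt_le_trans dL0 _.
  exact: CE_dose_ge (HGmeas h) (p0 h Gh hT) HDmeas (Dab h Gh hT).
have v0 h : Gset h -> (h <= TT)%N -> 0 < cvar P D (evG G h).
  move=> Gh hT.
  exact: cvar_gt0 (HGmeas h) (p0 h Gh hT) HDmeas ab (Dab h Gh hT) (H2a_cond h Gh hT).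
have tailC1 h f (Gh : Gset h) (hT : (h <= TT)%N) (cf : C1_on dL dU f) :=
  integral_condPr_C1 P G D h dL dU (HGmeas h) HDmeas ab (Dab h Gh hT) cf.
have tail h X m (Gh : Gset h) (hT : (h <= TT)%N) (rm : reg_fun P G D h X m) :=
  integral_condPr_reg_fun P G D h dL dU (HGmeas h) (p0 h Gh hT) HDmeas ab
    (Dab h Gh hT) rm.
have rid h (Gh : Gset h) (hT : (h <= TT)%N) :=
  reg_fun_id P G D h dL dU (HGmeas h) HDmeas (Dab h Gh hT).
have cid := C1_on_id dL dU.
have d1id (l : R) : derive1 id l = 1 by rewrite derive1E derive_id.
(* Common core of the two [w1] decompositions and of the mass of [w1]; the leftover [m dL] is what
   the [w0] terms compensate. *)
have int_w1 h X m : Gset h -> (h <= TT)%N -> reg_fun P G D h X m ->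
    C1_on dL dU m ->
    (\int[@lebesgue_measure R]_(l in `[dL, dU]) (w1 P G D h l * derive1 m l)%:E
     = ((CE P X (evG G h) - m dL) / CE P D (evG G h))%:E)%E.
  move=> Gh hT rm cm; have [i _] := tailC1 h m Gh hT cm.
  have := integral_scalel (CE P D (evG G h))^-1 _ i (tail h X m Gh hT rm cm).
  rewrite [X in _ = X%:E -> _]mulrC => <-.
  by apply: eq_integral => l _; congr EFin; rewrite /w1; ring.
(* The dose is bounded by [dU] on the whole space, being zero for never-treated units. *)
have iD : P.-integrable setT (EFin \o D).
  have i1 : P.-integrable setT (EFin \o (cst 1 : Omega -> R)).
    exact: finite_measure_integrable_cst.
  rewrite (_ : D = fun w => 1 * D w); last by apply/funext => w; rewrite mul1r.
  apply: (integrable_bounded_mul P (M := dU) i1 HDmeas) => w _.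
  have [GT|TG] := leqP (G w) TT.
    have /andP[dLD DdU] := (HGD w).2 GT.
    by rewrite ger0_norm// (le_trans (ltW dL0)).
  have GE : G w = TT.+1.
    by apply/eqP; rewrite eqn_leq TG andbT; have /andP[] := HGset _ (HGw w).
  by rewrite (HGD w).1// normr0 ltW// (lt_trans dL0).
split.
- move=> m rm cm.
  have iX : P.-integrable setT (EFin \o Wdiff Y (POST TT g) (PRE g)).
    exact: integrable_sub (iPOST g g2) iPRE.
  have [i E] := integral_dev_tail P G D g dL dU (HGmeas g) (p0 g Gg gT) HDmeas ab
    (Dab g Gg gT) iX rm cm.
  have := integral_scalel (cvar P D (evG G g))^-1 _ i E.
  rewrite [X in _ = X%:E -> _]mulrC => <-.
  by apply: eq_integral => l _; congr EFin; rewrite derive1_piD /w1within; ring.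
- move=> m rm cm.
  under eq_integral do rewrite derive1_piD.
  rewrite (int_w1 g _ m Gg gT rm cm) -EFinD; congr EFin.
  rewrite /deltaMidPre /w0 /piD /piG; field.
  by rewrite dLn0 gt_eqF// c0.
- move=> m rm cm.
  under eq_integral do rewrite derive1_piD.
  rewrite (int_w1 k _ m Gk kT rm cm) -EFinD; congr EFin.
  (* POST minus MID is (POST minus PRE) minus (MID minus PRE), which matches the difference of two
     [piG] terms; the untreated means then cancel. *)
  have WE A : measurable A ->
      CE P (Wdiff Y (POST TT k) (MID g k)) A =
      CE P (Wdiff Y (POST TT k) (PRE g)) A - CE P (Wdiff Y (MID g k) (PRE g)) A.
    move=> mA; rewrite -CE_sub//; last 2 first.
    - exact: integrable_sub (iPOST k k2) iPRE.
    - exact: integrable_sub iMID iPRE.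
    by congr (CE P _ A); apply/funext => w; rewrite /Wdiff; ring.
  rewrite /deltaPostMid /w0 /piD /piG.
  rewrite [CE P _ (evG G g) in LHS]WE// [CE P _ (evD0 D) in X in X / dL]WE//; field.
  by rewrite dLn0 gt_eqF// c0.
- move=> Dne mg mk rg cg rk ck.
  set Delta := CE P D (evG G g) - CE P D (evG G k).
  have Dn0 : Delta != 0 by rewrite subr_eq0.
  rewrite !derive1_piD.
  have [igg _] := tailC1 g mg Gg gT cg.
  (* Mixed term: tail of group [k] against the slope of group [g]. It occurs in both integrals of
     the claim and cancels, so its value is left unevaluated. *)
  have [ikg Ekg] := tailC1 k mg Gk kT cg.
  have [ikk _] := tailC1 k mk Gk kT ck.
  have Egg := tail g _ mg Gg gT rg cg; have Ekk := tail k _ mk Gk kT rk ck.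
  have := integral_scale_sub Delta^-1 _ _ ikk ikg Ekk Ekg.
  have := integral_scale_sub Delta^-1 _ _ igg ikg Egg Ekg.
  have W1 l : Delta^-1 * (condPr P (evDge D l) (evG G g) * derive1 mg l
      - condPr P (evDge D l) (evG G k) * derive1 mg l)
      = w1across P G D g k l * derive1 mg l by rewrite /w1across -/Delta; ring.
  have W2 l : Delta^-1 * (condPr P (evDge D l) (evG G k) * derive1 mk l
      - condPr P (evDge D l) (evG G k) * derive1 mg l)
      = tw1across P G D g k l * (derive1 mk l - derive1 mg l).
    by rewrite /tw1across -/Delta; ring.
  under eq_integral do rewrite W1.
  under [in X in _ -> X -> _]eq_integral do rewrite W2.
  move=> -> ->.
  rewrite -EFinD; congr EFin; rewrite /=.
  rewrite /deltaPostPre /tw0across -/Delta /piD; field.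
  by rewrite dLn0 Dn0 gt_eqF// p0.
split.
  move=> h hgk.
  have [Gh hT] : Gset h /\ (h <= TT)%N by case: hgk => ->.
  split.
  - move=> l _; split; last first.
      by rewrite /w1 divr_ge0 ?(ltW (c0 h Gh hT))// divr_ge0 ?fine_ge0.
    rewrite /w1within divr_ge0 ?(ltW (v0 h Gh hT))//.
    (* The numerator of the weight becomes a scaled tail expectation of the dose deviation. *)
    rewrite (dev_tail P G D h dL dU (HGmeas h) (p0 h Gh hT) HDmeas (Dab h Gh hT)).
    rewrite mulr_ge0 ?invr_ge0 ?(ltW (p0 h Gh hT))//.
    exact: dev_tail_ge0 (HGmeas h) (p0 h Gh hT) HDmeas (Dab h Gh hT) l.
  - by rewrite /w0 divr_ge0 ?(ltW (c0 h Gh hT))// ltW.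
  (* With outcome [D] and regression [id], the covariance is the variance, so the normalised mass is
     1. *)
  - have [i E] := integral_dev_tail P G D h dL dU (HGmeas h) (p0 h Gh hT) HDmeas ab
      (Dab h Gh hT) iD (rid h Gh hT) cid.
    have := integral_scalel (cvar P D (evG G h))^-1 _ i E.
    rewrite [X in _ = X%:E -> _]mulVf ?gt_eqF ?v0// => <-.
    by apply: eq_integral => l _; congr EFin; rewrite d1id /w1within; ring.
  (* The integral is [(E[D | G = h] - dL) / E[D | G = h]]; [w0] supplies the missing part below
     [dL]. *)
  - have := int_w1 h D id Gh hT (rid h Gh hT) cid.
    under eq_integral do rewrite d1id mulr1.
    move=> ->; rewrite -EFinD; congr EFin; rewrite /w0; field.
    by rewrite gt_eqF// c0.
move=> Dne.
set Delta := CE P D (evG G g) - CE P D (evG G k).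
have Dn0 : Delta != 0 by rewrite subr_eq0.
have [ig _] := tailC1 g id Gg gT cid.
have [ik _] := tailC1 k id Gk kT cid.
have := integral_scale_sub Delta^-1 _ _ ig ik (tail g _ id Gg gT (rid g Gg gT) cid)
  (tail k _ id Gk kT (rid k Gk kT) cid).
(* The two tail integrals are the group mean doses minus [dL]; their difference is [Delta]. *)
rewrite [X in _ = X%:E -> _](_ : _ = 1); last by rewrite /Delta; field.
move=> <-; apply: eq_integral => l _; congr EFin.
by rewrite !d1id /w1across -/Delta; ring.
Qed.
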